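(* Let $A$ be a finite set of $m$ alternatives and $N=\{1,\dots,n\}$ a set of agents, and let preferences range over all weak orders (complete and transitive binary relations) on $A$. If $m\ge 4$ and $n\ge 4$, then there is no social decision scheme $f\colon \mathcal{R}^N\to\Delta(A)$ that is simultaneously anonymous, neutral, efficient, and strategyproof.
   Context: $\mathcal{R}$ denotes the set of all complete and transitive binary relations (weak preferences) on $A$; a preference profile is $R=(\succsim_1,\dots,\succsim_n)\in\mathcal{R}^N$. $\Delta(A)=\{p\in\mathbb{R}_{\ge0}^A:\sum_{x\in A}p(x)=1\}$ is the set of lotteries. A social decision scheme (SDS) is a function $f\colon\mathcal{R}^N\to\Delta(A)$. For $R\in\mathcal{R}^N$, $i\in N$ and $\succsim\in\mathcal{R}$, $R_{i:\succsim}$ denotes the profile obtained from $R$ by replacing $\succsim_i$ with $\succsim$. Anonymity: $f(R)=f(R\circ\sigma)$ for all $R$ and all permutations $\sigma$ of $N$. Neutrality: $f(R)(x)=f(\pi(R))(\pi(x))$ for all $R$, all permutations $\pi$ of $A$ and all $x\in A$, where $\pi(R)$ replaces each $\succsim_i$ by $\succsim_i^\pi$ defined by $\pi(x)\succsim_i^\pi\pi(y)$ iff $x\succsim_i y$. A utility function $u_i\colon A\to\mathbb{R}$ is consistent with $\succsim_i$ if $u_i(x)\ge u_i(y)\iff x\succsim_i y$; it is extended to lotteries by $u_i(p)=\sum_{x}p(x)u_i(x)$. A utility representation $u$ assigns to each profile $R$ a tuple $(u^R_1,\dots,u^R_n)$ of utility functions with $u^R_i$ consistent with $\succsim_i$.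 For a representation $u$ and profile $R$, lottery $p$ $u$-dominates $q$ at $R$ if $u^R_i(p)\ge u^R_i(q)$ for all $i$ and $u^R_i(p)>u^R_i(q)$ for some $i$. $f$ is efficient if there is no profile $R$ such that $f(R)$ is $u$-dominated at $R$ for all utility representations $u$ (i.e., it never returns a lottery that is $u$-dominated for every $u$). $f$ is manipulable if there exist a profile $R$, an agent $i$ and a preference relation $\succsim$ such that $u^R_i(f(R_{i:\succsim}))>u^R_i(f(R))$ for all utility representations $u$; $f$ is strategyproof if it is not manipulable. *)

(* Defs.v *)
From mathcomp Require Import all_boot all_order all_algebra all_fingroup.
From mathcomp Require Export reals.
Set Implicit Arguments. Unset Strict Implicit. Unset Printing Implicit Defensive.
Import Order.TTheory GRing.Theory Num.Theory.
Local Open Scope ring_scope.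

Section SDS.
Variables (R : realType) (A : finType) (n : nat).

Definition weak_orderb (r : rel A) : bool :=
  [forall x, forall y, r x y || r y x] &&
  [forall x, forall y, forall z, r x y ==> r y z ==> r x z].

Record pref := Pref { prel : rel A; prefP : weak_orderb prel }.

Definition profile := 'I_n -> pref.

Definition upd (P : profile) (i : 'I_n) (s : pref) : profile :=
  fun j => if j == i then s else P j.

(* s^pi : pi x s^pi pi y  iff  x s y *)
Lemma perm_weak_order (pi : {perm A}) (r : rel A) :
  weak_orderb r -> weak_orderb (fun a b => r ((pi^-1)%g a) ((pi^-1)%g b)).
Proof.
move=> /andP[/forallP c /forallP t]; apply/andP; split; apply/forallP=> x;
  apply/forallP=> y.
  exact: (forallP (c _)).
apply/forallP=> z; exact: (forallP (forallP (t _) _)).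
Qed.

Definition perm_pref (pi : {perm A}) (s : pref) : pref :=
  Pref (perm_weak_order pi (prefP s)).

Definition perm_profile (pi : {perm A}) (P : profile) : profile :=
  fun i => perm_pref pi (P i).

Definition is_lottery (p : A -> R) : Prop :=
  (forall x, 0 <= p x) /\ \sum_(x : A) p x = 1.

Definition is_SDS (f : profile -> A -> R) : Prop := forall P, is_lottery (f P).

Definition anonymous (f : profile -> A -> R) : Prop :=
  forall (P : profile) (sigma : {perm 'I_n}) (x : A),
    f P x = f (fun i => P (sigma i)) x.

Definition neutral (f : profile -> A -> R) : Prop :=
  forall (P : profile) (pi : {perm A}) (x : A),
    f P x = f (perm_profile pi P) (pi x).

Definition consistent (u : A -> R) (s : pref) : Prop :=
  forall x y, u y <= u x <-> prel s x y.

Definition exp_util (u : A -> R) (p : A -> R) : R := \sum_(x : A) p x * u x.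

Definition utility_rep (u : profile -> 'I_n -> A -> R) : Prop :=
  forall P i, consistent (u P i) (P i).

Definition u_dominates (u : profile -> 'I_n -> A -> R) (P : profile)
    (p q : A -> R) : Prop :=
  (forall i, exp_util (u P i) q <= exp_util (u P i) p) /\
  (exists i, exp_util (u P i) q < exp_util (u P i) p).

Definition u_dominated (u : profile -> 'I_n -> A -> R) (P : profile)
    (q : A -> R) : Prop :=
  exists p, is_lottery p /\ u_dominates u P p q.

Definition efficient (f : profile -> A -> R) : Prop :=
  ~ exists P : profile,
      forall u, utility_rep u -> u_dominated u P (f P).

Definition manipulable (f : profile -> A -> R) : Prop :=
  exists (P : profile) (i : 'I_n) (s : pref),
    forall u, utility_rep u ->
      exp_util (u P i) (f P) < exp_util (u P i) (f (upd P i s)).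

Definition strategyproof (f : profile -> A -> R) : Prop := ~ manipulable f.

End SDS.

(* Main.v *)
(** Adding alternatives that everybody ranks last and agents that are
    indifferent between the other ones reduces the claim to four agents and four
    alternatives, where efficiency forces the new alternatives to have
    probability 0.  By Abel summation, moving probability so that every upper
    contour set of a preference gains raises the expected utility for every
    consistent utility function; so efficiency makes certain probabilities
    vanish, and strategyproofness says that a misreport never (weakly) raises
    the probability of all upper contour sets, one of them strictly.  The
    resulting linear constraints on the lotteries of 24 profiles, taken up to
    relabelling of agents and alternatives, are contradictory. *)
Require Import Defs.
From mathcomp Require Import all_boot all_order all_algebra all_fingroup.
From mathcomp Require Import reals.
From mathcomp Require Import lra.
From Stdlib Require Import FunctionalExtensionality.
Set Implicit Arguments. Unset Strict Implicit. Unset Printing Implicit Defensive.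
Import Order.TTheory GRing.Theory Num.Theory.

Section StochasticDominance.
Local Open Scope ring_scope.
Variables (R : realType) (A : finType).
Implicit Types (D u : A -> R) (r : A -> nat).

Lemma sum_layers r D (c : nat -> R) (v : R) K :
  (forall z, (r z < K)%N) -> \sum_z D z = 0 ->
  \sum_z D z * (v + \sum_((r z).+1 <= k < K) c k)
  = \sum_(0 <= k < K) c k * \sum_(z | (r z < k)%N) D z.
Proof.
move=> rK D0.
under eq_bigr do rewrite mulrDr.
rewrite big_split /= -mulr_suml D0 mul0r add0r.
under [RHS]eq_bigr do rewrite mulr_sumr big_mkcond /=.
rewrite exchange_big /=; apply: eq_bigr => z _.
rewrite mulr_sumr [RHS](big_cat_nat (n := (r z).+1)) //=.
rewrite [X in _ = X + _]big_nat [X in _ = X + _]big1 ?add0r; last first.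
  by move=> k /andP[_ kz]; rewrite ltnNge -ltnS kz.
rewrite !big_nat; apply: eq_bigr => k /andP[zk _].
by rewrite zk mulrC.
Qed.

Lemma expectation_sd r D u :
  (forall x y, u y <= u x <-> (r x <= r y)%N) -> \sum_z D z = 0 ->
  (forall z, 0 <= \sum_(y | (r y < r z)%N) D y) ->
  0 <= \sum_z D z * u z /\
  ((exists z, 0 < \sum_(y | (r y < r z)%N) D y) -> 0 < \sum_z D z * u z).
Proof.
move=> ur D0 Dge0.
pose M := 1 + \sum_z `|u z|.
have uM z : u z < M.
  rewrite /M (bigD1 z) //= addrCA ltr_pwDr //; last exact: ler_norm.
  by rewrite ltr_wpDr // sumr_ge0.
pose phi k := \big[Num.min/M]_(x | (r x < k)%N) u x.
have phiS z : phi (r z).+1 = u z.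
  apply/le_anti/andP; split; first by apply: bigmin_le_cond.
  by apply/bigmin_geP; split=> [|x xz]; [exact: ltW | exact/ur].
have phi_anti k : phi k.+1 <= phi k.
  apply/bigmin_geP; split=> [|x xk]; first exact: bigmin_le_id.
  by apply: bigmin_le_cond; exact: ltnW.
pose K := (\max_z r z).+1.
have rK z : (r z < K)%N by rewrite ltnS; exact: leq_bigmax.
have -> : \sum_z D z * u z
        = \sum_(0 <= k < K) (phi k - phi k.+1) * \sum_(z | (r z < k)%N) D z.
  rewrite -(sum_layers (fun k => phi k - phi k.+1) (phi K) rK D0).
  apply: eq_bigr => z _; congr (_ * _).
  under eq_bigr do rewrite -opprB.
  by rewrite sumrN telescope_sumr // opprB addrC subrK phiS.
have layer_ge0 k : 0 <= (phi k - phi k.+1) * \sum_(z | (r z < k)%N) D z.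
  have [z /eqP <-|nok] := pickP (fun z => r z == k).
    by rewrite mulr_ge0 // subr_ge0.
  suff -> : phi k.+1 = phi k by rewrite subrr mul0r.
  by apply: eq_bigl => z; rewrite ltnS leq_eqVlt nok.
split; first by apply: sumr_ge0 => k _.
move=> [z Dz]; rewrite big_mkord (bigD1 (Ordinal (rK z))) //=.
rewrite ltr_pwDl ?sumr_ge0 // mulr_gt0 // subr_gt0 phiS.
apply/bigmin_gtP; split=> // x xz.
by rewrite ltNge; apply/negP => /ur; rewrite leqNgt xz.
Qed.

Lemma sum_count_mem (Q : pred A) (s : seq A) :
  \sum_(y | Q y) (count_mem y s)%:R = (count Q s)%:R :> R.
Proof.
elim: s => [|x s IHs] /=; first by rewrite big1.
under eq_bigr do rewrite natrD.
rewrite big_split /= IHs natrD; congr (_ + _).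
rewrite big_mkcond (bigD1 x) //= eqxx big1 ?addr0 => [|y yx]; first by case: (Q x).
by rewrite eq_sym (negPf yx); case: (Q y).
Qed.

Variable n : nat.
Variable f : profile A n -> A -> R.
Hypothesis f_sds : is_SDS f.

Lemma efficient_swap (P : profile A n) (r : 'I_n -> A -> nat) (X Y : seq A) :
  efficient f -> (forall i x y, prel (P i) x y = (r i x <= r i y)%N) ->
  uniq X -> size X = size Y ->
  (forall i z, count (fun x => r i x < r i z) X <= count (fun x => r i x < r i z) Y)%N ->
  (exists i z, count (fun x => r i x < r i z) X < count (fun x => r i x < r i z) Y)%N ->
  has (fun x => f P x == 0) X.
Proof.
move=> feff Pr Xuniq XY leXY [i0 [z0 ltXY]].
have [fP0 fP1] := f_sds P.
apply: contraPT (feff) => /hasPn fX /=; apply; exists P => u hu.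
have [e e0 ef] : exists2 e : R, 0 < e & forall x, x \in X -> e <= f P x.
  elim: X fX {Xuniq XY leXY ltXY} => [|x X IHX] fX; first by exists 1.
  have [|e e0 he] := IHX; first by move=> y yX; rewrite fX // inE yX orbT.
  exists (Num.min e (f P x)).
    by rewrite lt_min e0 lt0r fX ?mem_head //=.
  move=> y; rewrite inE => /predU1P[->|/he yX]; first by rewrite ge_min lexx orbT.
  by rewrite ge_min yX.
pose D y : R := (count_mem y Y)%:R - (count_mem y X)%:R.
have sumD (Q : pred A) : \sum_(y | Q y) D y = (count Q Y)%:R - (count Q X)%:R.
  by rewrite sumrB !sum_count_mem.
have D0 : \sum_y D y = 0 by rewrite sumD !count_predT XY subrr.
have gain i : 0 <= \sum_z D z * u P i z /\
    ((exists z, 0 < \sum_(y | (r i y < r i z)%N) D y) -> 0 < \sum_z D z * u P i z).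
  apply: (@expectation_sd (r i)) => // [x y|z].
    by have := hu P i x y; rewrite /= Pr.
  by rewrite sumD subr_ge0 ler_nat.
have gainE i : exp_util (u P i) (fun y => f P y + e * D y)
             = exp_util (u P i) (f P) + e * \sum_z D z * u P i z.
  rewrite /exp_util mulr_sumr -big_split; apply: eq_bigr => z _ /=.
  by rewrite mulrDl mulrA.
exists (fun y => f P y + e * D y); split; last split.
- split=> [y|]; last by rewrite big_split /= fP1 -mulr_sumr D0 mulr0 addr0.
  have [yX|yX] := boolP (y \in X).
    have : e * (count_mem y Y)%:R >= 0 by rewrite mulr_ge0 // ltW.
    by have := ef _ yX; rewrite /D (count_uniq_mem _ Xuniq) yX mulrBr mulr1; lra.
  by rewrite /D (count_uniq_mem _ Xuniq) (negPf yX) subr0 addr_ge0 // mulr_ge0 // ltW.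
- by move=> i; rewrite gainE lerDl mulr_ge0 ?(ltW e0) //; case: (gain i).
exists i0; rewrite gainE ltrDl mulr_gt0 //; apply: (gain i0).2.
by exists z0; rewrite sumD subr_gt0 ltr_nat.
Qed.

Lemma strategyproof_sd (P : profile A n) (r : A -> nat) i s :
  strategyproof f -> (forall x y, prel (P i) x y = (r x <= r y)%N) ->
  (forall z, \sum_(y | (r y < r z)%N) f P y <= \sum_(y | (r y < r z)%N) f (upd P i s) y) ->
  ~ exists z, \sum_(y | (r y < r z)%N) f P y < \sum_(y | (r y < r z)%N) f (upd P i s) y.
Proof.
move=> fsp Pr le [z lt]; apply: fsp; exists P, i, s => u hu.
pose D y := f (upd P i s) y - f P y.
have D0 : \sum_y D y = 0 by rewrite sumrB (f_sds _).2 (f_sds _).2 subrr.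
have [||_ gain] := @expectation_sd r D (u P i) _ D0.
- by move=> x y; have := hu P i x y; rewrite /= Pr.
- by move=> y; rewrite sumrB subr_ge0.
rewrite /exp_util -subr_gt0 -sumrB.
under eq_bigr do rewrite -mulrBl.
by apply: gain; exists z; rewrite sumrB subr_gt0.
Qed.

End StochasticDominance.

(** A weak order on the alternatives 0, 1, 2, 3 is the list of their ranks, the
    best rank being 0: [:: 1; 0; 2; 0] stands for 1 ~ 3 > 0 > 2.  The default
    rank 4 puts every other alternative at the bottom. *)
Notation ranking := (seq nat).

Definition rank (o : ranking) (x : nat) : nat := nth 4 o x.
Definition is_ranking (o : ranking) : bool := (size o == 4) && all (fun k => k < 4) o.
Definition wf (P : seq ranking) : bool := (size P == 4) && all is_ranking P.
Definition is_relabelling (pi : seq nat) : bool := perm_eq pi (iota 0 4).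
Definition relabel (pi : seq nat) (o : ranking) : ranking :=
  mkseq (fun y => rank o (index y pi)) 4.
Definition is_sym (P : seq ranking) (pi : seq nat) : bool :=
  [&& wf P, is_relabelling pi & perm_eq (map (relabel pi) P) P].
Definition upper_sets (o : ranking) : seq (seq nat) :=
  [seq [seq x <- iota 0 4 | rank o x < k] | k <- undup o & 0 < k].

(** Moving probability from [X] to [Y] makes no agent worse off and one better
    off. *)
Definition improves (P : seq ranking) (X Y : seq nat) : bool :=
  [&& wf P, uniq X, all (fun x => x < 4) (X ++ Y), size X == size Y,
   all (fun o => all (fun k => count (fun x => rank o x < k) X
                            <= count (fun x => rank o x < k) Y) o) P
   & has (fun o => has (fun k => count (fun x => rank o x < k) X
                               < count (fun x => rank o x < k) Y) o) P].

(** If agent [i] of [P] reports [s], the profile becomes [Q], once alternative [x]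
    is renamed [nth 0 pi x] and up to the order of the agents. *)
Definition deviation (P : seq ranking) (i : nat) (s : ranking)
    (Q : seq ranking) (pi : seq nat) : bool :=
  [&& wf P, i < 4, is_ranking s, is_relabelling pi
    & perm_eq (map (relabel pi) (set_nth [::] P i s)) Q].

(** Unlike a big sum, [mass p X] unfolds by computation on a concrete [X]. *)
Fixpoint mass (R : realFieldType) (p : nat -> R) (X : seq nat) : R :=
  (if X is x :: X' then (if X' is [::] then p x else p x + mass p X') else 0)%R.

Lemma massE (R : realFieldType) (p : nat -> R) X : mass p X = (\sum_(x <- X) p x)%R.
Proof.
elim: X => [|x [|y X] IHX]; rewrite ?big_nil ?big_seq1 //.
by rewrite big_cons -IHX.
Qed.

Section Reduction.
Variables (R : realType) (A : finType) (n : nat) (z0 : A).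
Variable f : profile A n -> A -> R.
Hypotheses (A_ge4 : 4 <= #|A|) (n_ge4 : 4 <= n).
Hypotheses (f_sds : is_SDS f) (f_anon : anonymous f) (f_neut : neutral f).
Hypotheses (f_eff : efficient f) (f_sp : strategyproof f).

Definition idx (z : A) : nat := index z (enum A).
Definition alt (x : nat) : A := nth z0 (enum A) x.

Lemma altK x : x < 4 -> idx (alt x) = x.
Proof.
by move=> x4; rewrite /idx index_uniq ?enum_uniq // -cardE (leq_trans x4).
Qed.

Lemma idxK z : alt (idx z) = z.
Proof. by rewrite /alt nth_index // mem_enum. Qed.

Lemma ranking_weak_order (o : ranking) :
  weak_orderb (fun x y => rank o (idx x) <= rank o (idx y)).
Proof.
apply/andP; split; apply/forallP=> x; apply/forallP=> y; first exact: leq_total.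
by apply/forallP=> z; apply/implyP=> xy; apply/implyP; exact: leq_trans.
Qed.

Definition ranking_pref (o : ranking) : pref A := Pref (ranking_weak_order o).

Definition indifferent : ranking := [:: 0; 0; 0; 0].

(** Agents beyond the length of [P] are indifferent between 0, 1, 2 and 3. *)
Definition embed (P : seq ranking) : profile A n :=
  fun i => ranking_pref (nth indifferent P i).

Definition prob (P : seq ranking) (x : nat) : R := f (embed P) (alt x).

Lemma pref_inj (s t : pref A) : prel s = prel t -> s = t.
Proof.
case: s t => [r rP] [r' r'P] /= rr'; case: _ / rr' in r'P *.
by rewrite (eq_irrelevance rP r'P).
Qed.

Lemma wf_nth P i : wf P -> is_ranking (nth indifferent P i).
Proof.
move=> /andP[_ /allP Pall]; have [iP|iP] := ltnP i (size P).
  by apply: Pall; exact: mem_nth.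
by rewrite nth_default.
Qed.

Lemma rank_lt4 o x : is_ranking o -> (rank o x < 4) = (x < 4).
Proof.
move=> /andP[/eqP o4 /allP oall]; have [x4|x4] := ltnP x 4.
  by apply: oall; rewrite mem_nth // o4.
by rewrite /rank nth_default // o4.
Qed.

Lemma rank_bottom o x : is_ranking o -> 4 <= x -> rank o x = 4.
Proof. by move=> /andP[/eqP o4 _] x4; rewrite /rank nth_default // o4. Qed.

Lemma rank_in o x : is_ranking o -> x < 4 -> rank o x \in o.
Proof. by move=> /andP[/eqP o4 _] x4; rewrite mem_nth // o4. Qed.

Lemma bottom_null P z : wf P -> 4 <= idx z -> f (embed P) z = 0%R.
Proof.
move=> wfP z4; apply/eqP.
have := @efficient_swap R A n f f_sds (embed P)
  (fun i x => rank (nth indifferent P i) (idx x)) [:: z] [:: alt 0] f_eff.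
rewrite /= orbF; apply=> // [i t|]; rewrite ?addn0.
  case: ltnP => // zt; rewrite altK //.
  suff -> : rank (nth indifferent P i) 0 < rank (nth indifferent P i) (idx t) by [].
  by apply: ltn_trans zt; rewrite (rank_bottom (wf_nth _ wfP) z4) rank_lt4 ?wf_nth.
exists (Ordinal (leq_trans (isT : 0 < 4) n_ge4)), z.
by rewrite ltnn altK // (rank_bottom (wf_nth _ wfP) z4) rank_lt4 ?wf_nth.
Qed.

Lemma sum_embed P (Q : pred A) : wf P ->
  (\sum_(z | Q z) f (embed P) z = \sum_(x <- iota 0 4 | Q (alt x)) prob P x)%R.
Proof.
move=> wfP; transitivity (\sum_(z <- enum A | Q z) f (embed P) z)%R.
  by rewrite big_enum_cond.
have -> : enum A = map alt (iota 0 4 ++ iota 4 (#|A| - 4)).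
  by rewrite -iotaD subnKC // cardE map_nth_iota0 // take_size.
rewrite big_map big_cat /= [X in (_ + X)%R]big_seq_cond [X in (_ + X)%R]big1 ?addr0 //.
move=> x /andP[]; rewrite mem_iota subnKC // => /andP[x4 xA] _.
by apply: bottom_null => //; rewrite /idx index_uniq ?enum_uniq // -cardE.
Qed.

Lemma prob_lottery P : wf P ->
  ([/\ 0 <= prob P 0, 0 <= prob P 1, 0 <= prob P 2, 0 <= prob P 3
    & prob P 0 + prob P 1 + prob P 2 + prob P 3 = 1])%R.
Proof.
move=> wfP; have [f0 f1] := f_sds (embed P).
split; rewrite /prob ?f0 //.
by move: f1; rewrite sum_embed //= !big_cons big_nil addr0 !addrA.
Qed.

Lemma prob_eff P X Y : improves P X Y -> has (fun x => prob P x == 0%R) X.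
Proof.
case/and4P=> wfP Xuniq; rewrite all_cat => /andP[/allP X4 /allP Y4].
case/and3P=> /eqP XY /allP le lt.
have count_alt (Z : seq nat) (r : nat -> nat) k : {in Z, forall x, x < 4} ->
    count (fun z => r (idx z) < k) (map alt Z) = count (fun x => r x < k) Z.
  by move=> Z4; rewrite count_map; apply: eq_in_count => x /Z4 x4 /=; rewrite altK.
rewrite -(has_map alt (fun z => f (embed P) z == 0%R)).
have P4 : size P = 4 by case/andP: wfP => /eqP.
apply: (@efficient_swap R A n f f_sds (embed P)
  (fun i x => rank (nth indifferent P i) (idx x)) _ (map alt Y) f_eff) => //.
- rewrite map_inj_in_uniq // => x y xX yX xy.
  by rewrite -(altK (X4 _ xX)) xy altK // X4.
- by rewrite !size_map.
- move=> i z; rewrite !count_alt //.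
  set o := nth indifferent P i.
  have oR : is_ranking o by exact: wf_nth.
  have [i4|i4] := ltnP i 4; last first.
    have -> : o = indifferent by rewrite /o nth_default // P4.
    have [z4|z4] := ltnP (idx z) 4.
      have -> : rank indifferent (idx z) = 0 by move: (idx z) z4; do 4![case=> //].
      by rewrite (eq_count (a2 := pred0)) ?count_pred0 // => x; rewrite /= ltn0.
    rewrite (rank_bottom (o := indifferent)) //.
    rewrite !(eq_in_count (a2 := predT)) ?count_predT ?XY // => x.
      by move=> /Y4 x4 /=; rewrite rank_lt4.
    by move=> /X4 x4 /=; rewrite rank_lt4.
  have [z4|z4] := ltnP (idx z) 4.
    have oP : o \in P by rewrite mem_nth // P4.
    exact: (allP (le o oP) _ (rank_in oR z4)).
  rewrite (rank_bottom oR z4).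
  rewrite !(eq_in_count (a2 := predT)) ?count_predT ?XY // => x.
    by move=> /Y4 x4 /=; rewrite rank_lt4.
  by move=> /X4 x4 /=; rewrite rank_lt4.
case/hasP: lt => o oP /hasP[k ko lt].
have iP : index o P < 4 by rewrite -P4 index_mem.
have oE : nth indifferent P (index o P) = o by rewrite nth_index.
have oR : is_ranking o by rewrite -oE wf_nth.
have kx : index k o < 4 by case/andP: oR => /eqP <- _; rewrite index_mem.
exists (Ordinal (leq_trans iP n_ge4)), (alt (index k o)).
by rewrite /= oE !count_alt // altK // /rank nth_index.
Qed.

Lemma embed_perm P Q : size P <= n -> perm_eq P Q -> f (embed P) =1 f (embed Q).
Proof.
move=> Pn PQ z; pose pad S := S ++ nseq (n - size P) indifferent.
have padE S i : nth indifferent S i = nth indifferent (pad S) i.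
  rewrite nth_cat; case: ltnP => // iS.
  by rewrite nth_nseq nth_default //; case: ifP.
have padn S : perm_eq P S -> size (pad S) == n.
  by move=> /perm_size PS; rewrite size_cat size_nseq -PS subnKC.
pose tP := Tuple (padn P (perm_refl P)); pose tQ := Tuple (padn Q PQ).
have /tuple_permP[s ts] : perm_eq tQ tP by rewrite perm_cat2r perm_sym.
rewrite (f_anon (embed P) s z); congr (f _ z).
apply: functional_extensionality => i; rewrite /embed; congr ranking_pref.
have -> : nth indifferent Q i = nth indifferent tQ i by exact: padE.
by rewrite ts -tnth_nth tnth_mktuple (tnth_nth indifferent); exact: padE.
Qed.

Section Relabel.
Variable pi : seq nat.
Hypothesis pi_relab : is_relabelling pi.

Lemma relab_uniq : uniq pi. Proof. by rewrite (perm_uniq pi_relab) iota_uniq. Qed.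
Lemma relab_size : size pi = 4. Proof. by rewrite (perm_size pi_relab) size_iota. Qed.
Lemma mem_relab x : (x \in pi) = (x < 4).
Proof. by rewrite (perm_mem pi_relab) mem_iota. Qed.
Lemma relab_lt4 x : x < 4 -> nth 0 pi x < 4.
Proof. by move=> x4; rewrite -mem_relab mem_nth // relab_size. Qed.

Definition move_alt (z : A) : A := if idx z < 4 then alt (nth 0 pi (idx z)) else z.

Lemma move_alt_inj : injective move_alt.
Proof.
apply: (can_inj (g := fun z => if idx z < 4 then alt (index (idx z) pi) else z)).
move=> z; rewrite /move_alt; have [z4|z4] := ltnP (idx z) 4; last by rewrite ltnNge z4.
rewrite !altK ?relab_lt4 // index_uniq ?relab_uniq ?relab_size //.
exact: idxK.
Qed.

Lemma rank_relabel o z : is_ranking o ->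
  rank (relabel pi o) (idx (move_alt z)) = rank o (idx z).
Proof.
move=> oR; rewrite /move_alt; have [z4|z4] := ltnP (idx z) 4.
  rewrite altK ?relab_lt4 // {1}/rank nth_mkseq ?relab_lt4 //.
  by rewrite index_uniq ?relab_uniq ?relab_size.
by rewrite (rank_bottom oR z4) /rank nth_default // size_mkseq.
Qed.

Lemma relabel_indifferent : relabel pi indifferent = indifferent.
Proof.
apply: (@eq_from_nth _ 4); first by rewrite size_mkseq.
move=> x; rewrite size_mkseq => x4; rewrite nth_mkseq //.
have : index x pi < 4 by rewrite -[X in _ < X]relab_size index_mem mem_relab.
by rewrite /rank; case: (index x pi) => [|[|[|[|]]]] // _; move: x x4; do 4![case=> //].
Qed.

Lemma perm_profile_embed P : wf P ->
  perm_profile (perm move_alt_inj) (embed P) = embed (map (relabel pi) P).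
Proof.
move=> wfP; apply: functional_extensionality => i; apply: pref_inj.
apply: functional_extensionality => x; apply: functional_extensionality => y /=.
have -> : nth indifferent (map (relabel pi) P) i = relabel pi (nth indifferent P i).
  have [iP|iP] := ltnP i (size P); first exact: nth_map.
  by rewrite !nth_default ?size_map // relabel_indifferent.
have rk t : rank (relabel pi (nth indifferent P i)) (idx t)
          = rank (nth indifferent P i) (idx ((perm move_alt_inj)^-1%g t)).
  by rewrite -{1}(permKV (perm move_alt_inj) t) permE rank_relabel ?wf_nth.
by rewrite !rk.
Qed.

Lemma prob_relabel P Q x : wf P -> perm_eq (map (relabel pi) P) Q -> x < 4 ->
  prob Q (nth 0 pi x) = prob P x.
Proof.
move=> wfP PQ x4; rewrite /prob -(embed_perm _ PQ); last first.
  by rewrite size_map; case/andP: wfP => /eqP -> _.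
rewrite (f_neut (embed P) (perm move_alt_inj)) perm_profile_embed //.
by rewrite permE /move_alt altK // x4.
Qed.

End Relabel.

Lemma prob_sym P pi x : is_sym P pi -> x < 4 -> prob P (nth 0 pi x) = prob P x.
Proof. by case/and3P => wfP pi_relab Ppi; exact: prob_relabel. Qed.

Lemma prob_strat P i s Q pi U Us :
  deviation P i s Q pi && perm_eq (U :: Us) (upper_sets (nth [::] P i)) ->
  ~~ (all (fun V => mass (prob P) V <= mass (prob Q) (map (nth 0 pi) V))%R Us
      && (mass (prob P) U < mass (prob Q) (map (nth 0 pi) U))%R).
Proof.
case/andP=> /and5P[wfP i4 sR pi_relab devQ] uppers.
have P4 : size P = 4 by case/andP: wfP => /eqP.
have oE : nth [::] P i = nth indifferent P i by apply: set_nth_default; rewrite P4.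
rewrite oE in uppers; set o := nth indifferent P i in uppers.
have oR : is_ranking o by exact: wf_nth.
set P' := set_nth [::] P i s in devQ.
have wfP' : wf P'.
  rewrite /wf size_set_nth P4 (maxn_idPr i4) /=.
  apply/allP => t /(nthP [::])[j]; rewrite size_set_nth P4 (maxn_idPr i4) => j4 <-.
  rewrite nth_set_nth /=; case: eqP => // _.
  by rewrite (set_nth_default indifferent) ?P4 ?wf_nth.
pose i' := Ordinal (leq_trans i4 n_ge4).
have updE : upd (embed P) i' (ranking_pref s) = embed P'.
  apply: functional_extensionality => j; rewrite /upd /embed /P'.
  have [->|ji] := eqVneq j i'.
    rewrite (set_nth_default [::]) ?size_set_nth ?P4 ?(maxn_idPr i4) //=.
    by rewrite nth_set_nth /= eqxx.
  have {}ji : (nat_of_ord j == i) = false by apply: contraNF ji => /eqP ji; apply/eqP/val_inj.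
  congr ranking_pref; have [j4|j4] := ltnP j 4; last first.
    by rewrite !nth_default ?size_set_nth ?P4 ?(maxn_idPr i4).
  rewrite [RHS](set_nth_default [::]) ?size_set_nth ?P4 ?(maxn_idPr i4) //.
  by rewrite nth_set_nth /= ji; apply: set_nth_default; rewrite P4.
have sumE S k : wf S -> (\sum_(z | (rank o (idx z) < k)%N) f (embed S) z
    = \sum_(x <- [seq x <- iota 0 4 | (rank o x < k)%N]) prob S x)%R.
  move=> wfS; rewrite sum_embed // big_filter big_seq_cond [RHS]big_seq_cond.
  apply: eq_bigl => x; rewrite mem_iota /=; case: ltnP => //= x4.
  by rewrite altK.
have massQ V : {subset V <= iota 0 4} ->
    mass (prob Q) (map (nth 0 pi) V) = (\sum_(x <- V) prob P' x)%R.
  move=> V4; rewrite massE big_map !big_seq; apply: eq_bigr => x /V4.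
  by rewrite mem_iota => x4; exact: prob_relabel.
have upperP V : V \in U :: Us -> exists2 k, k \in o & V = [seq x <- iota 0 4 | rank o x < k].
  rewrite (perm_mem uppers) => /mapP[k]; rewrite mem_filter mem_undup => /andP[_ ko] ->.
  by exists k.
have Usub V : V \in U :: Us -> {subset V <= iota 0 4}.
  by case/upperP => k _ -> x; rewrite mem_filter => /andP[].
apply/negP => /andP[/allP le lt].
apply: (@strategyproof_sd R A n f f_sds (embed P) (fun z => rank o (idx z)) i'
  (ranking_pref s) f_sp) => // [z|]; last first.
  have [k ko UE] := upperP U (mem_head _ _).
  have kx : index k o < 4 by case/andP: oR => /eqP <- _; rewrite index_mem.
  exists (alt (index k o)); rewrite updE !sumE // altK // /rank nth_index // -/rank.
  by move: lt; rewrite (massQ _ (Usub _ (mem_head _ _))) massE UE.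
rewrite updE !sumE //; have [z4|z4] := ltnP (idx z) 4; last first.
  rewrite (rank_bottom oR z4) (eq_in_filter (a2 := predT)) ?filter_predT; last first.
    by move=> x; rewrite mem_iota rank_lt4.
  have total S : wf S -> (\sum_(x <- iota 0 4) prob S x = 1)%R.
    by move=> wfS; rewrite -(f_sds (embed S)).2 sum_embed.
  by rewrite !total.
have [->|k0] := posnP (rank o (idx z)).
  by rewrite (eq_filter (a2 := pred0)) ?filter_pred0 ?big_nil.
set V := filter _ _.
have VU : V \in U :: Us.
  rewrite (perm_mem uppers); apply/mapP; exists (rank o (idx z)) => //.
  by rewrite mem_filter k0 mem_undup rank_in.
rewrite -massE -(massQ _ (Usub _ VU)).
by move: VU; rewrite inE => /predU1P[->|/le //]; exact: ltW.
Qed.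

End Reduction.

(** The 24 profiles and the order of the deductions below were found by a
    computer search over the linear constraints. *)
Definition P1 := [:: [:: 0; 0; 1; 1]; [:: 1; 1; 0; 0]; [:: 0; 2; 0; 1]; [:: 1; 0; 2; 0]].
Definition P2 := [:: [:: 0; 0; 1; 1]; [:: 1; 1; 0; 0]; [:: 0; 3; 1; 2]; [:: 1; 1; 2; 0]].
Definition P3 := [:: [:: 0; 0; 1; 1]; [:: 1; 1; 0; 0]; [:: 1; 1; 2; 0]; [:: 0; 2; 1; 1]].
Definition P4 := [:: [:: 1; 1; 0; 0]; [:: 0; 0; 1; 1]; [:: 0; 2; 0; 1]; [:: 1; 1; 2; 0]].
Definition P5 := [:: [:: 0; 0; 1; 1]; [:: 1; 0; 2; 0]; [:: 0; 1; 0; 1]; [:: 1; 2; 0; 0]].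
Definition P6 := [:: [:: 0; 1; 0; 1]; [:: 1; 2; 0; 0]; [:: 1; 0; 2; 0]; [:: 0; 1; 3; 2]].
Definition P7 := [:: [:: 0; 0; 1; 1]; [:: 1; 1; 0; 0]; [:: 1; 0; 2; 0]; [:: 0; 3; 1; 2]].
Definition P8 := [:: [:: 0; 0; 1; 1]; [:: 1; 1; 0; 0]; [:: 1; 0; 2; 0]; [:: 0; 1; 0; 1]].
Definition P9 := [:: [:: 0; 0; 1; 1]; [:: 1; 1; 0; 0]; [:: 1; 1; 2; 0]; [:: 1; 2; 0; 3]].
Definition P10 := [:: [:: 1; 1; 0; 0]; [:: 0; 0; 1; 1]; [:: 2; 1; 3; 0]; [:: 1; 2; 0; 2]].
Definition P11 := [:: [:: 0; 0; 1; 1]; [:: 1; 1; 0; 0]; [:: 0; 1; 0; 1]; [:: 2; 1; 3; 0]].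
Definition P12 := [:: [:: 0; 1; 0; 1]; [:: 1; 0; 1; 0]; [:: 0; 1; 2; 2]; [:: 2; 2; 0; 1]].
Definition P13 := [:: [:: 0; 0; 1; 1]; [:: 0; 2; 1; 2]; [:: 1; 2; 1; 0]; [:: 2; 0; 2; 1]].
Definition P14 := [:: [:: 0; 2; 1; 0]; [:: 2; 2; 1; 0]; [:: 1; 1; 0; 2]; [:: 0; 1; 2; 2]].
Definition P15 := [:: [:: 0; 2; 1; 0]; [:: 0; 1; 2; 2]; [:: 0; 0; 0; 1]; [:: 2; 2; 1; 0]].
Definition P16 := [:: [:: 0; 0; 1; 1]; [:: 0; 1; 1; 2]; [:: 1; 1; 0; 0]; [:: 3; 0; 2; 1]].
Definition P17 := [:: [:: 0; 0; 1; 1]; [:: 0; 3; 1; 2]; [:: 1; 0; 2; 1]; [:: 2; 2; 0; 1]].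
Definition P18 := [:: [:: 0; 0; 1; 1]; [:: 2; 2; 1; 0]; [:: 0; 0; 0; 1]; [:: 0; 3; 2; 1]].
Definition P19 := [:: [:: 0; 0; 1; 1]; [:: 1; 1; 0; 0]; [:: 0; 3; 1; 2]; [:: 0; 0; 1; 0]].
Definition P20 := [:: [:: 0; 0; 1; 1]; [:: 0; 1; 1; 0]; [:: 0; 0; 0; 1]; [:: 2; 2; 1; 0]].
Definition P21 := [:: [:: 0; 0; 1; 1]; [:: 0; 2; 1; 0]; [:: 2; 2; 1; 0]; [:: 0; 0; 0; 1]].
Definition P22 := [:: [:: 1; 1; 0; 0]; [:: 0; 0; 1; 1]; [:: 0; 2; 0; 1]; [:: 0; 0; 1; 0]].
Definition P23 := [:: [:: 0; 0; 0; 1]; [:: 0; 0; 1; 1]; [:: 1; 1; 0; 0]; [:: 1; 2; 2; 0]].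
Definition P24 := [:: [:: 0; 0; 1; 1]; [:: 0; 2; 1; 0]; [:: 2; 2; 1; 0]; [:: 1; 1; 0; 2]].

Section FourByFour.
Local Open Scope ring_scope.
Variables (R : realFieldType) (g : seq ranking -> nat -> R).

Hypothesis lottery : forall P, wf P ->
  [/\ 0 <= g P 0, 0 <= g P 1, 0 <= g P 2, 0 <= g P 3
    & g P 0 + g P 1 + g P 2 + g P 3 = 1].
Hypothesis sym : forall P pi x, is_sym P pi -> (x < 4)%N -> g P (nth 0%N pi x) = g P x.
Hypothesis eff : forall P X Y, improves P X Y -> has (fun x => g P x == 0) X.
(** Not every upper contour set of agent [i] of [P] weakly gains from the
    deviation to [Q] while one of them, [U], strictly gains. *)
Hypothesis strat : forall P i s Q pi U Us,
  deviation P i s Q pi && perm_eq (U :: Us) (upper_sets (nth [::] P i)) ->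
  ~~ (all (fun V => mass (g P) V <= mass (g Q) (map (nth 0%N pi) V)) Us
      && (mass (g P) U < mass (g Q) (map (nth 0%N pi) U))).

Ltac pareto t := by have := t isT; rewrite /= orbF => /eqP.
Ltac sp t :=
  rewrite leNgt; have := t isT;
  apply: contraNN => ? /=; rewrite ?andbT; repeat (apply/andP; split); lra.

Lemma value_P1 : [/\ g P1 0 = 2^-1, g P1 1 = 0, g P1 2 = 0 & g P1 3 = 2^-1].
Proof.
  have [? ? ? ? ?] := @lottery P1 isT.
  have ? : g P1 3 = g P1 0 := @sym P1 [:: 3; 2; 1; 0] 0 isT isT.
  have ? : g P1 2 = g P1 1 := @sym P1 [:: 3; 2; 1; 0] 1 isT isT.
  have := @eff P1 [:: 1; 2] [:: 0; 3] isT.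
  by rewrite /= orbF => /orP[]/eqP ?; split; lra.
Qed.

Lemma value_P4_P2 :
  [/\ g P4 0 = 2^-1, g P4 1 = 0, g P4 2 = 0 & g P4 3 = 2^-1] /\
  [/\ g P2 0 = 2^-1, g P2 1 = 0, g P2 2 = 0 & g P2 3 = 2^-1].
Proof.
  have [? ? ? ? ?] := @lottery P4 isT.
  have [? ? ? ? ?] := @lottery P2 isT.
  have [? ? ? ? ?] := @lottery P3 isT.
  have [? ? ? ?] := value_P1.
  have ? : g P2 1 = 0 by pareto (@eff P2 [:: 1] [:: 0]).
  have ? : g P2 0 + g P2 2 <= g P4 0 + g P4 2.
    by sp (@strat P4 2 [:: 0; 3; 1; 2] P2 [:: 0; 1; 2; 3]
      [:: 0; 2] [:: [:: 0; 2; 3]]).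
  have ? : g P1 3 <= g P4 3.
    by sp (@strat P4 3 [:: 1; 0; 2; 0] P1 [:: 0; 1; 2; 3]
      [:: 3] [:: [:: 0; 1; 3]]).
  have ? : g P3 1 = 0 by pareto (@eff P3 [:: 1] [:: 0]).
  have ? : g P3 3 = g P3 0 := @sym P3 [:: 3; 2; 1; 0] 0 isT isT.
  have ? : g P3 2 = g P3 1 := @sym P3 [:: 3; 2; 1; 0] 1 isT isT.
  have ? : g P3 0 <= g P2 0.
    by sp (@strat P2 2 [:: 0; 2; 1; 1] P3 [:: 0; 1; 2; 3]
      [:: 0] [:: [:: 0; 2]; [:: 0; 2; 3]]).
  have ? : g P1 0 + g P1 1 + g P1 3 <= g P4 0 + g P4 1 + g P4 3.
    by sp (@strat P4 3 [:: 1; 0; 2; 0] P1 [:: 0; 1; 2; 3]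
      [:: 0; 1; 3] [:: [:: 3]]).
  by split; split; lra.
Qed.

Lemma value_P6_P5_P7 :
  [/\ g P6 0 = 2^-1, g P6 1 = 0, g P6 2 = 0 & g P6 3 = 2^-1] /\
  [/\ g P5 0 = 2^-1, g P5 1 = 0, g P5 2 = 0 & g P5 3 = 2^-1] /\
  g P7 0 = 2^-1 /\ g P7 1 = 0.
Proof.
  have [? ? ? ? ?] := @lottery P6 isT.
  have [? ? ? ? ?] := @lottery P5 isT.
  have [? ? ? ? ?] := @lottery P7 isT.
  have [? ? ? ?] := value_P1.
  have [[? ? ? ?] [? ? ? ?]] := value_P4_P2.
  have ? : g P5 2 = g P5 1 := @sym P5 [:: 0; 2; 1; 3] 1 isT isT.
  have ? : g P5 1 = 0.
    have := @eff P5 [:: 1; 2] [:: 0; 3] isT.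
    by rewrite /= orbF => /orP[]/eqP ?; lra.
  have ? : g P6 0 + g P6 1 <= g P5 0 + g P5 1.
    by sp (@strat P5 0 [:: 0; 1; 3; 2] P6 [:: 0; 1; 2; 3] [:: 0; 1] [::]).
  have ? : g P5 0 <= g P6 0.
    by sp (@strat P6 3 [:: 0; 0; 1; 1] P5 [:: 0; 1; 2; 3]
      [:: 0] [:: [:: 0; 1]; [:: 0; 1; 3]]).
  have ? : g P5 0 + g P5 1 + g P5 3 <= g P6 0 + g P6 1 + g P6 3.
    by sp (@strat P6 3 [:: 0; 0; 1; 1] P5 [:: 0; 1; 2; 3]
      [:: 0; 1; 3] [:: [:: 0]; [:: 0; 1]]).
  have ? : g P6 1 + g P6 3 <= g P7 2 + g P7 3.
    by sp (@strat P7 1 [:: 1; 2; 0; 0] P6 [:: 0; 2; 1; 3] [:: 2; 3] [::]).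
  have ? : g P7 0 + g P7 2 + g P7 3 <= g P6 0 + g P6 1 + g P6 3.
    by sp (@strat P6 2 [:: 1; 0; 1; 0] P7 [:: 0; 2; 1; 3]
      [:: 0; 1; 3] [:: [:: 1; 3]]).
  have ? : g P2 1 + g P2 3 <= g P7 1 + g P7 3.
    by sp (@strat P7 2 [:: 1; 1; 2; 0] P2 [:: 0; 1; 2; 3]
      [:: 1; 3] [:: [:: 0; 1; 3]]).
  have ? : g P4 3 <= g P7 0.
    by sp (@strat P7 3 [:: 0; 2; 1; 1] P4 [:: 3; 2; 1; 0]
      [:: 0] [:: [:: 0; 2]; [:: 0; 2; 3]]).
  have ? : g P4 3 + g P4 1 + g P4 0 <= g P7 0 + g P7 2 + g P7 3.
    by sp (@strat P7 3 [:: 0; 2; 1; 1] P4 [:: 3; 2; 1; 0]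
      [:: 0; 2; 3] [:: [:: 0]; [:: 0; 2]]).
  have ? : g P7 2 + g P7 3 <= g P6 1 + g P6 3.
    by sp (@strat P6 2 [:: 1; 0; 1; 0] P7 [:: 0; 2; 1; 3]
      [:: 1; 3] [:: [:: 0; 1; 3]]).
  by do ![split]; lra.
Qed.

Lemma P8_2 : g P8 2 = 0.
Proof.
  have [? ? ? ? ?] := @lottery P8 isT.
  have [? ? ? ?] := value_P1.
  have [[? ? ? ?] [[? ? ? ?] _]] := value_P6_P5_P7.
  have := @eff P8 [:: 1; 2] [:: 0; 3] isT.
  rewrite /= orbF => /orP[]/eqP // ?.
  have ? : g P8 0 + g P8 2 <= g P1 0 + g P1 2.
    by sp (@strat P1 2 [:: 0; 1; 0; 1] P8 [:: 0; 1; 2; 3]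
      [:: 0; 2] [:: [:: 0; 2; 3]]).
  have ? : g P8 2 + g P8 3 <= g P5 1 + g P5 3.
    by sp (@strat P5 1 [:: 1; 0; 1; 0] P8 [:: 0; 2; 1; 3]
      [:: 1; 3] [:: [:: 0; 1; 3]]).
  by lra.
Qed.

Lemma value_P11_P9 :
  [/\ [/\ g P11 0 = 2^-1, g P11 1 = 0, g P11 2 = 0 & g P11 3 = 2^-1],
    g P9 1 = 0, g P9 3 = 2^-1 & g P10 0 + g P10 2 = 2^-1].
Proof.
  have [? ? ? ? ?] := @lottery P11 isT.
  have [? ? ? ? ?] := @lottery P8 isT.
  have [? ? ? ? ?] := @lottery P9 isT.
  have [? ? ? ? ?] := @lottery P10 isT.
  have ? := P8_2.
  have [[? ? ? ?] _] := value_P4_P2.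
  have [_ [[? ? ? ?] _]] := value_P6_P5_P7.
  have ? : g P9 1 = 0 by pareto (@eff P9 [:: 1] [:: 0]).
  have ? : g P9 0 + g P9 2 <= g P4 0 + g P4 2.
    by sp (@strat P4 2 [:: 1; 2; 0; 3] P9 [:: 0; 1; 2; 3]
      [:: 0; 2] [:: [:: 0; 2; 3]]).
  have ? : g P9 1 + g P9 3 <= g P10 0 + g P10 2.
    by sp (@strat P10 3 [:: 1; 1; 0; 2] P9 [:: 1; 0; 3; 2]
      [:: 0; 2] [:: [:: 2]]).
  have ? : g P10 0 + g P10 2 <= g P11 0 + g P11 2.
    by sp (@strat P11 2 [:: 1; 2; 0; 2] P10 [:: 0; 1; 2; 3] [:: 0; 2] [::]).
  have ? : g P5 2 + g P5 3 <= g P8 2 + g P8 3.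
    by sp (@strat P8 1 [:: 1; 2; 0; 0] P5 [:: 0; 1; 2; 3] [:: 2; 3] [::]).
  have ? : g P8 3 <= g P11 3.
    by sp (@strat P11 3 [:: 1; 0; 2; 0] P8 [:: 0; 1; 2; 3]
      [:: 3] [:: [:: 1; 3]; [:: 0; 1; 3]]).
  have ? : g P8 1 + g P8 3 <= g P11 1 + g P11 3.
    by sp (@strat P11 3 [:: 1; 0; 2; 0] P8 [:: 0; 1; 2; 3]
      [:: 1; 3] [:: [:: 3]; [:: 0; 1; 3]]).
  have ? : g P8 0 + g P8 1 + g P8 3 <= g P11 0 + g P11 1 + g P11 3.
    by sp (@strat P11 3 [:: 1; 0; 2; 0] P8 [:: 0; 1; 2; 3]
      [:: 0; 1; 3] [:: [:: 3]; [:: 1; 3]]).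
  by do ![split]; lra.
Qed.

Lemma value_P12_P10 :
  [/\ g P12 0 = 2^-1, g P12 1 = 0, g P12 2 = 2^-1 & g P12 3 = 0] /\
  [/\ g P10 0 = 0, g P10 1 = 0, g P10 2 = 2^-1 & g P10 3 = 2^-1].
Proof.
  have [? ? ? ? ?] := @lottery P12 isT.
  have [? ? ? ? ?] := @lottery P10 isT.
  have [[? ? ? ?] ? ? ?] := value_P11_P9.
  have ? : g P12 2 = g P12 0 := @sym P12 [:: 2; 3; 0; 1] 0 isT isT.
  have ? : g P12 3 = g P12 1 := @sym P12 [:: 2; 3; 0; 1] 1 isT isT.
  have ? : g P10 3 <= g P12 0.
    by sp (@strat P12 2 [:: 0; 1; 3; 2] P10 [:: 3; 1; 2; 0]
      [:: 0] [:: [:: 0; 1]]).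
  have ? : g P12 1 + g P12 3 + g P12 2 <= g P10 0 + g P10 1 + g P10 3.
    by sp (@strat P10 2 [:: 2; 1; 2; 0] P12 [:: 1; 3; 0; 2]
      [:: 0; 1; 3] [:: [:: 3]; [:: 1; 3]]).
  have ? : g P9 3 <= g P10 2.
    by sp (@strat P10 3 [:: 1; 1; 0; 2] P9 [:: 1; 0; 3; 2]
      [:: 2] [:: [:: 0; 2]]).
  have ? : g P12 2 <= g P10 3.
    by sp (@strat P10 2 [:: 2; 1; 2; 0] P12 [:: 1; 3; 0; 2]
      [:: 3] [:: [:: 1; 3]; [:: 0; 1; 3]]).
  by do ![split]; lra.
Qed.

Lemma P21_P20_1 : g P21 1 = 0 /\ g P20 1 = 0.
Proof.
  have [? ? ? ? ?] := @lottery P21 isT.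
  have [? ? ? ? ?] := @lottery P20 isT.
  have ? : g P20 1 = 0 by pareto (@eff P20 [:: 1] [:: 0]).
  have ? : g P21 0 + g P21 3 <= g P20 0 + g P20 3.
    by sp (@strat P20 1 [:: 0; 2; 1; 0] P21 [:: 0; 1; 2; 3] [:: 0; 3] [::]).
  have ? : g P20 0 + g P20 2 + g P20 3 <= g P21 0 + g P21 2 + g P21 3.
    by sp (@strat P21 1 [:: 0; 1; 1; 0] P20 [:: 0; 1; 2; 3]
      [:: 0; 2; 3] [:: [:: 0; 3]]).
  by split; lra.
Qed.

Lemma P21_le_P24 : g P21 0 <= g P24 0 + g P24 1.
Proof.
  have [? ? ? ? ?] := @lottery P21 isT.
  have [? ? ? ? ?] := @lottery P15 isT.
  have [? ? ? ? ?] := @lottery P14 isT.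
  have [? ? ? ? ?] := @lottery P13 isT.
  have [[? ? ? ?] _] := value_P12_P10.
  have [? _] := P21_P20_1.
  have ? : g P13 2 + g P13 3 <= g P12 1 + g P12 3.
    by sp (@strat P12 1 [:: 1; 1; 2; 0] P13 [:: 0; 2; 1; 3] [:: 1; 3] [::]).
  have ? : g P13 0 + g P13 1 <= g P14 0 + g P14 3.
    by sp (@strat P14 0 [:: 0; 1; 1; 0] P13 [:: 0; 2; 3; 1]
      [:: 0; 3] [:: [:: 0; 2; 3]]).
  have ? : g P15 0 + g P15 1 + g P15 2 <= g P14 0 + g P14 1 + g P14 2.
    by sp (@strat P14 2 [:: 0; 0; 0; 1] P15 [:: 0; 1; 2; 3]
      [:: 0; 1; 2] [:: [:: 2]]).
  have ? : g P21 0 + g P21 1 <= g P15 0 + g P15 1.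
    by sp (@strat P15 1 [:: 0; 0; 1; 1] P21 [:: 0; 1; 2; 3]
      [:: 0; 1] [:: [:: 0]]).
  have ? : g P14 0 + g P14 1 <= g P24 0 + g P24 1.
    by sp (@strat P24 0 [:: 0; 1; 2; 2] P14 [:: 0; 1; 2; 3] [:: 0; 1] [::]).
  by lra.
Qed.

Lemma P17_2_P18_3 : g P17 2 = 0 /\ g P18 3 = 0.
Proof.
  have [? ? ? ? ?] := @lottery P16 isT.
  have [? ? ? ? ?] := @lottery P17 isT.
  have [? ? ? ? ?] := @lottery P18 isT.
  have [_ [? ? ? ?]] := value_P12_P10.
  have [[? ? ? ?] _ _ _] := value_P11_P9.
  have ? : g P10 2 <= g P16 0.
    by sp (@strat P16 1 [:: 0; 2; 1; 2] P10 [:: 2; 3; 0; 1]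
      [:: 0] [:: [:: 0; 1; 2]]).
  have ? : g P16 2 + g P16 0 <= g P11 0 + g P11 2.
    by sp (@strat P11 2 [:: 1; 2; 0; 1] P16 [:: 2; 3; 0; 1] [:: 0; 2] [::]).
  have ? : g P10 2 + g P10 3 + g P10 0 <= g P16 0 + g P16 1 + g P16 2.
    by sp (@strat P16 1 [:: 0; 2; 1; 2] P10 [:: 2; 3; 0; 1]
      [:: 0; 1; 2] [:: [:: 0]]).
  have ? : g P17 3 + g P17 2 <= g P16 2 + g P16 3.
    by sp (@strat P16 2 [:: 2; 2; 1; 0] P17 [:: 1; 0; 3; 2] [:: 2; 3] [::]).
  have ? : g P17 0 + g P17 1 + g P17 3 <= g P18 0 + g P18 1 + g P18 2.
    by sp (@strat P18 2 [:: 1; 0; 1; 2] P17 [:: 0; 1; 3; 2] [:: 0; 1; 2] [::]).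
  by split; lra.
Qed.

Lemma P21_3_P22 : [/\ g P21 3 = 0, g P22 1 = 0 & g P22 2 = 0].
Proof.
  have [? ? ? ? ?] := @lottery P18 isT.
  have [? ? ? ? ?] := @lottery P17 isT.
  have [? ? ? ? ?] := @lottery P19 isT.
  have [? ? ? ? ?] := @lottery P21 isT.
  have [? ? ? ? ?] := @lottery P22 isT.
  have [? ? ? ? ?] := @lottery P7 isT.
  have [? ?] := P17_2_P18_3.
  have [? _] := P21_P20_1.
  have [_ [_ [? ?]]] := value_P6_P5_P7.
  have ? : g P19 1 = 0 by pareto (@eff P19 [:: 1] [:: 0]).
  have ? : g P7 3 + g P7 2 + g P7 0 <= g P22 0 + g P22 1 + g P22 3.
    by sp (@strat P22 3 [:: 2; 1; 3; 0] P7 [:: 3; 2; 1; 0] [:: 0; 1; 3] [::]).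
  have ? : g P19 0 + g P19 2 <= g P22 0 + g P22 2.
    by sp (@strat P22 2 [:: 0; 3; 1; 2] P19 [:: 0; 1; 2; 3]
      [:: 0; 2] [:: [:: 0; 2; 3]]).
  have ? : g P17 0 + g P17 1 + g P17 3 <= g P18 0 + g P18 1 + g P18 2.
    by sp (@strat P18 2 [:: 1; 0; 1; 2] P17 [:: 0; 1; 3; 2] [:: 0; 1; 2] [::]).
  have ? : g P19 3 + g P19 2 <= g P18 2 + g P18 3.
    by sp (@strat P18 1 [:: 1; 1; 0; 0] P19 [:: 0; 1; 3; 2]
      [:: 2; 3] [:: [:: 3]]).
  have ? : g P21 0 <= g P18 0.
    by sp (@strat P18 3 [:: 0; 2; 1; 0] P21 [:: 0; 1; 2; 3]
      [:: 0] [:: [:: 0; 3]; [:: 0; 2; 3]]).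
  have ? : g P21 3 + g P21 2 <= g P22 2 + g P22 3.
    by sp (@strat P22 0 [:: 2; 2; 0; 1] P21 [:: 0; 1; 3; 2] [:: 2; 3] [::]).
  have ? : g P21 0 + g P21 3 <= g P18 0 + g P18 3.
    by sp (@strat P18 3 [:: 0; 2; 1; 0] P21 [:: 0; 1; 2; 3]
      [:: 0; 3] [:: [:: 0]; [:: 0; 2; 3]]).
  by split; lra.
Qed.

Lemma no_scheme_on_four : False.
Proof.
  have [? ? ? ? ?] := @lottery P21 isT.
  have [? ? ? ? ?] := @lottery P24 isT.
  have [? ? ? ? ?] := @lottery P22 isT.
  have [? ? ? ? ?] := @lottery P20 isT.
  have [? ? ? ? ?] := @lottery P23 isT.
  have [? ? ?] := P21_3_P22.
  have [? ?] := P21_P20_1.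
  have ? := P21_le_P24.
  have [_ [? ? ? ?]] := value_P12_P10.
  have [[? ? ? ?] _] := value_P4_P2.
  have ? : g P23 1 = 0 by pareto (@eff P23 [:: 1] [:: 0]).
  have ? : g P23 0 + g P23 3 <= g P22 0 + g P22 2.
    by sp (@strat P22 2 [:: 1; 2; 0; 2] P23 [:: 0; 1; 3; 2]
      [:: 0; 2] [:: [:: 0; 2; 3]]).
  have ? : g P21 0 + g P21 1 + g P21 2 <= g P24 0 + g P24 1 + g P24 2.
    by sp (@strat P24 3 [:: 0; 0; 0; 1] P21 [:: 0; 1; 2; 3]
      [:: 0; 1; 2] [:: [:: 2]]).
  have ? : g P4 3 + g P4 2 <= g P24 2 + g P24 3.
    by sp (@strat P24 2 [:: 1; 1; 0; 0] P4 [:: 0; 1; 3; 2]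
      [:: 2; 3] [:: [:: 3]]).
  have ? : g P21 3 + g P21 2 <= g P22 2 + g P22 3.
    by sp (@strat P22 0 [:: 2; 2; 0; 1] P21 [:: 0; 1; 3; 2] [:: 2; 3] [::]).
  have ? : g P20 0 + g P20 3 <= g P21 0 + g P21 3.
    by sp (@strat P21 1 [:: 0; 1; 1; 0] P20 [:: 0; 1; 2; 3]
      [:: 0; 3] [:: [:: 0; 2; 3]]).
  have ? : g P20 2 + g P20 1 <= g P23 0 + g P23 1.
    by sp (@strat P23 1 [:: 1; 0; 0; 1] P20 [:: 2; 1; 0; 3] [:: 0; 1] [::]).
  have ? : g P23 1 + g P23 2 <= g P10 1 + g P10 3.
    by sp (@strat P10 2 [:: 0; 0; 1; 0] P23 [:: 0; 1; 3; 2]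
      [:: 1; 3] [:: [:: 3]; [:: 0; 1; 3]]).
  have ? : g P23 0 + g P23 1 + g P23 2 <= g P10 0 + g P10 1 + g P10 3.
    by sp (@strat P10 2 [:: 0; 0; 1; 0] P23 [:: 0; 1; 3; 2]
      [:: 0; 1; 3] [:: [:: 3]; [:: 1; 3]]).
  by lra.
Qed.

End FourByFour.

Theorem theorem3p1 (R : realType) (A : finType) (n : nat) :
  (4 <= #|A|)%N -> (4 <= n)%N ->
  ~ exists f : profile A n -> A -> R,
      [/\ is_SDS f, anonymous f, neutral f, efficient f & strategyproof f].
Proof.
move=> A4 n4 [f [f_sds f_anon f_neut f_eff f_sp]].
have /card_gt0P[z0 _] : 0 < #|A| by exact: leq_trans A4.
apply: (@no_scheme_on_four R (prob z0 f)).
- exact: prob_lottery.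
- by move=> P pi x; exact: prob_sym.
- exact: prob_eff.
- exact: prob_strat.
Qed.
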